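(* Let $X$ be a real linear space and $D\subseteq X$ a nonempty convex set. If $\lambda\in[0,1]\setminus\mathbb{Q}$ and $x,y$ are distinct elements of $D$, then there exists a Jensen convex function $f:D\to\mathbb{R}$ such that $$f(\lambda x+(1-\lambda)y)>\lambda f(x)+(1-\lambda)f(y).$$
   Context: A function $f:D\to\mathbb{R}$ is Jensen convex on $D$ if $f\big(\frac{u+v}{2}\big)\leq\frac12f(u)+\frac12f(v)$ for all $u,v\in D$. *)

(* Defs.v *)
From mathcomp Require Import all_boot all_order all_algebra.
From mathcomp Require Import all_classical all_reals all_analysis.

Set Implicit Arguments.
Unset Strict Implicit.
Unset Printing Implicit Defensive.

Import Order.TTheory GRing.Theory Num.Theory.

Local Open Scope classical_set_scope.
Local Open Scope ring_scope.

(* As with [convex_function], a function D -> R is represented by a total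
   function X -> R of which only the values on D matter; for convex D the
   midpoints occurring below lie in D. *)
Definition jensen_convex (R : realType) (X : lmodType R) (D : set X)
    (f : X -> R) : Prop :=
  forall u v : X, D u -> D v ->
    f (2^-1 *: (u + v)) <= 2^-1 * f u + 2^-1 * f v.

(* Main.v *)
Require Import Defs.
From HB Require Import structures.
From mathcomp Require Import all_boot all_order all_algebra.
From mathcomp Require Import all_classical all_reals all_analysis.

Import Order.TTheory GRing.Theory Num.Theory.

Local Open Scope classical_set_scope.
Local Open Scope ring_scope.

(** The witness is an additive function [f], for which Jensen convexity holds
    with equality.  Put [d := x - y], so that the point of interest is
    [y + lambda *: d].  Over the field of rationals, [d] and [lambda *: d] are
    linearly independent because [lambda] is irrational and [d] is nonzero;
    hence there is a rational-linear [f : X -> rat] with [f d = 0] and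
    [f (lambda *: d) = 1].  Then [f x = f y], so the right-hand side of the
    inequality is [f y], while the left-hand side is [f y + 1].

    Such an [f] comes from [separating_functional]: over any field, a vector
    [v] outside a subspace [W] is mapped to [1] by a linear functional that
    vanishes on [W].  By Zorn's lemma there is a subspace [H] maximal among
    those that contain [W] and avoid [v] ([maximal_avoiding_subspace]).
    Maximality makes [H] a hyperplane complementary to the line of [v]
    ([maximal_avoiding_complement]), and the functional is the coordinate
    along [v]. *)

Section Subspaces.
Context {F : fieldType} {V : lmodType F}.
Implicit Types (W H : set V) (u v w : V).

Definition subspace W :=
  W 0 /\ forall (a : F) u w, W u -> W w -> W (a *: u + w).

Lemma subspaceZ {W} a {u} : subspace W -> W u -> W (a *: u).
Proof. by move=> [W0 Wlin] Wu; rewrite -[_ *: _]addr0; exact: Wlin. Qed.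

Lemma subspaceD {W u w} : subspace W -> W u -> W w -> W (u + w).
Proof. by move=> [W0 Wlin] Wu Ww; rewrite -[u]scale1r; exact: Wlin. Qed.

Lemma subspaceB {W u w} : subspace W -> W u -> W w -> W (u - w).
Proof.
by move=> sW Wu Ww; rewrite -scaleN1r; apply: subspaceD => //; exact: subspaceZ.
Qed.

Lemma subspace_line u : subspace [set w | exists a : F, w = a *: u].
Proof.
split=> [|a _ _ [b ->] [c ->]]; first by exists 0; rewrite scale0r.
by exists (a * b + c); rewrite scalerDl scalerA.
Qed.

Lemma subspace_adjoin {W} u : subspace W ->
  subspace [set w | exists2 h, W h & exists a : F, w = h + a *: u].
Proof.
move=> [W0 Wlin]; split=> [|a _ _ [g Wg [b ->]] [h Wh [c ->]]].
  by exists 0 => //; exists 0; rewrite scale0r addr0.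
exists (a *: g + h); first exact: Wlin.
by exists (a * b + c); rewrite scalerDr scalerDl scalerA addrACA.
Qed.

Lemma maximal_avoiding_subspace {W v} : subspace W -> ~ W v ->
  exists H, [/\ subspace H, W `<=` H, ~ H v &
    forall K, subspace K -> H `<=` K -> ~ K v -> K `<=` H].
Proof.
move=> sW Wv.
(* Zorn's lemma is applied to the sets [A] completing [W] into a subspace,
   rather than to the subspaces containing [W], so that the union of the empty
   chain is admissible. *)
have [|A [[sWA WAv] maxA]] :=
    @Zorn_bigcup V [set A | subspace (W `|` A) /\ ~ (W `|` A) v].
  move=> C CP totC; split; last first.
    by move=> [//|[A CA Av]]; have [_] := CP _ CA; apply; right.
  have inC A : C A -> W `|` A `<=` W `|` \bigcup_(B in C) B.
    by move=> CA w [Ww|Aw]; [left|right; exists A].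
  split=> [|a u w]; first by left; case: sW.
  have lift A : C A -> (W `|` A) u -> (W `|` A) w ->
      (W `|` \bigcup_(B in C) B) (a *: u + w).
    by move=> CA Au Aw; have [[_ lin] _] := CP _ CA; apply: (inC A CA); exact: lin.
  move=> [Wu|[A CA Au]] [Ww|[B CB Bw]].
  - by left; apply: sW.2.
  - by apply: (lift B) => //; [left|right].
  - by apply: (lift A) => //; [right|left].
  - have [AB|BA] := totC _ _ CA CB.
    + by apply: (lift B) => //; right => //; exact: AB.
    + by apply: (lift A) => //; right => //; exact: BA.
exists (W `|` A); split=> // K sK HK Kv w Kw.
apply: contrapT => Hw.
have WK : W `|` K = K by apply: setUidr => u Wu; apply: HK; left.
apply: (maxA K); last by split; rewrite WK.
split=> [u Au|E]; last by apply: Hw; right; exact: E.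
by apply: HK; right.
Qed.

(** Adjoining [z] to [H] either changes nothing or, by maximality, captures [v];
    in the latter case [v = h + a *: z] with [a] nonzero, and solving for [z]
    gives the claim. *)
Lemma maximal_avoiding_complement {H v} : subspace H -> ~ H v ->
    (forall K, subspace K -> H `<=` K -> ~ K v -> K `<=` H) ->
  forall z, exists a : F, H (z - a *: v).
Proof.
move=> sH Hv maxH z.
set K := [set w | exists2 h, H h & exists a : F, w = h + a *: z].
have HK : H `<=` K by move=> h Hh; exists h => //; exists 0; rewrite scale0r addr0.
have [[h Hh [a vE]]|Kv] := pselect (K v); last first.
  exists 0; rewrite scale0r subr0; apply: (maxH K) => //.
    exact: subspace_adjoin.
  by exists 0; [case: sH|exists 1; rewrite scale1r add0r].
have a0 : a != 0.
  by apply/eqP => a0; apply: Hv; rewrite vE a0 scale0r addr0.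
exists a^-1; rewrite vE scalerDr scalerA mulVf // scale1r opprD addrCA subrr addr0.
by rewrite -scaleNr; exact: subspaceZ.
Qed.

(** The functional is the coordinate along [v] in the decomposition of the space
    as a direct sum of a maximal [v]-avoiding subspace and the line of [v]. *)
Lemma separating_functional {W v} : subspace W -> ~ W v ->
  exists f : V -> F, [/\ linear_for *%R f, forall w, W w -> f w = 0 & f v = 1].
Proof.
move=> sW Wv; have [H [sH WH Hv maxH]] := maximal_avoiding_subspace sW Wv.
have /choice[f fP] := maximal_avoiding_complement sH Hv maxH.
have fE z a : H (z - a *: v) -> f z = a.
  move=> Hz; apply/eqP; rewrite -subr_eq0; apply: contrapT => /negP faN0.
  apply: Hv; rewrite -[v]scale1r -(mulVf faN0) -scalerA; apply: subspaceZ => //.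
  have -> : (f z - a) *: v = (z - a *: v) - (z - f z *: v).
    by rewrite scalerBl opprB [RHS]addrC addrA subrK.
  exact: subspaceB.
exists f; split=> [a u w|w Ww|].
- apply: fE.
  have -> : a *: u + w - (a * f u + f w) *: v =
      a *: (u - f u *: v) + (w - f w *: v).
    by rewrite scalerDl opprD addrACA -scalerA -scalerBr.
  by apply: sH.2.
- by apply: fE; rewrite scale0r subr0; exact: WH.
- by apply: fE; rewrite scale1r subrr; case: sH.
Qed.

End Subspaces.

Section RestrictScalars.
Context {R : numFieldType} {X : lmodType R}.

(** A copy of the carrier of [X], so that its structure of vector space over the
    rationals does not compete with the one over [R]. *)
Definition rat_restriction : Type := X.

HB.instance Definition _ := GRing.Zmodule.copy rat_restriction X.

Let ratscale (q : rat) (u : rat_restriction) : rat_restriction :=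
  ratr q *: (u : X).

Let ratscaleA a b u : ratscale a (ratscale b u) = ratscale (a * b) u.
Proof. by rewrite /ratscale scalerA rmorphM. Qed.

Let ratscale1 : left_id 1 ratscale.
Proof. by move=> u; rewrite /ratscale rmorph1 scale1r. Qed.

Let ratscaleDr : right_distributive ratscale +%R.
Proof. by move=> a u w; exact: scalerDr. Qed.

Let ratscaleDl u : {morph ratscale^~ u : a b / a + b}.
Proof. by move=> a b; rewrite /ratscale rmorphD scalerDl. Qed.

HB.instance Definition _ := GRing.Zmodule_isLmodule.Build rat rat_restriction
  ratscaleA ratscale1 ratscaleDr ratscaleDl.

Lemma rat_separating_functional (d v : X) :
    (forall q : rat, v <> ratr q *: d) ->
  exists f : X -> rat,
    [/\ forall (q : rat) u w, f (ratr q *: u + w) = q * f u + f w,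
        f d = 0 & f v = 1].
Proof.
move=> indep.
have [[q vE]|f [flin fline fv]] :=
    @separating_functional rat rat_restriction _ v (subspace_line (d : rat_restriction)).
  exact: (indep q).
exists f; split=> //.
by apply: fline; exists 1; rewrite scale1r.
Qed.

End RestrictScalars.

Theorem theorem1p2 (R : realType) (X : lmodType R) (D : set X)
    (D_nonempty : D !=set0) (D_convex : convex_set D)
    (lambda : R) (lambdaP : (`[0, 1] `\` rational) lambda)
    (x y : X) (Dx : D x) (Dy : D y) (xy : x <> y) :
  exists f : X -> R, jensen_convex D f /\
    f (lambda *: x + (1 - lambda) *: y) > lambda * f x + (1 - lambda) * f y.
Proof.
have dN0 : x - y != 0 by rewrite subr_eq0; exact/eqP.
have [q /eqP|f [flin fd fv]] :=
    @rat_separating_functional R X (x - y) (lambda *: (x - y)).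
  rewrite -subr_eq0 -scalerBl scaler_eq0 (negbTE dN0) orbF subr_eq0 => /eqP lE.
  by case: lambdaP => _; apply; exists q.
have f_add u w : f (u + w) = f u + f w.
  by have := flin 1 u w; rewrite rmorph1 scale1r mul1r.
exists (fun z => ratr (f z)); split=> [u w _ _|].
  have f0 : f 0 = 0 by apply: (addrI (f 0)); rewrite -f_add !addr0.
  have f_half z : f (2^-1 *: z) = 2^-1 * f z.
    have := flin 2^-1 z 0.
    by rewrite !addr0 f0 addr0 fmorphV rmorph_nat.
  by rewrite f_half f_add rmorphM rmorphD /= fmorphV rmorph_nat mulrDr.
have fxy : f x = f y by rewrite -[x](subrK y) f_add fd add0r.
have -> : lambda *: x + (1 - lambda) *: y = lambda *: (x - y) + y.
  by rewrite scalerBr scalerBl scale1r addrA addrAC.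
rewrite f_add fv fxy rmorphD rmorph1 -mulrDl subrKC mul1r.
by rewrite ltrDr ltr01.
Qed.
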